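(* Let $S$ be a closed surface with a cellular decomposition $\Sigma=(V,E,F)$ in which every face has an even number of edges and every vertex has even degree, and let $q\in(0,1]$ be a constant. A spherical orthogonal ring pattern on $(S,\Sigma)$ with constant $q$ is uniquely determined by its modified combinatorial total geodesic curvature. That is, if two spherical orthogonal ring patterns on $(S,\Sigma)$ with the same constant $q$, given by inner radii $(r_1,\dots,r_{|F|})$ and $(r_1',\dots,r_{|F|}')$ in $(0,\frac{\pi}{2})^{|F|}$, have the same modified combinatorial total geodesic curvatures $L_i=L_i'$ for all $i\in\{1,\dots,|F|\}$, then $r_i=r_i'$ for all $i$; equivalently, the map $(0,\frac{\pi}{2})^{|F|}\to\mathbb{R}^{|F|}$, $(r_1,\dots,r_{|F|})\mapsto(L_1,\dots,L_{|F|})$, is injective.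
   Context: $V,E,F$ are the (finite) sets of vertices, edges and faces of $\Sigma$; faces are $f_1,\dots,f_{|F|}$, each being a polygon with a positive even number of edges. Write $e<f_i$ if $e$ is an edge of $f_i$. Each edge $e$ is incident to two faces $f_i,f_j$ (its two sides); if both sides of $e$ are the same face, both sides are counted in sums over edges of that face. Ring pattern. A radius function assigns to each face $f_i$ an inner radius $r_i\in(0,\frac{\pi}{2})$; the outer radius $R_i\in(0,\frac{\pi}{2})$ is defined by $\cos R_i=q\cos r_i$. The face $f_i$ corresponds to a ring $T_i$ centered at a point $O_i$ of $f_i$ with inner radius $r_i$ and outer radius $R_i$. To an edge $e$ incident to $f_i$ and $f_j$ corresponds the spherical quadrilateral $O_iv_1O_jv_2$ (in the unit sphere, unique up to isometry) with $\angle O_iv_1O_j=\angle O_iv_2O_j=\frac{\pi}{2}$, $|O_iv_1|=r_i$, $|O_iv_2|=R_i$, $|O_jv_1|=R_j$, $|O_jv_2|=r_j$; it expresses that the inner circle of $T_i$ is orthogonal to the outer circle of $T_j$ and the outer circle of $T_i$ is orthogonal to the inner circle of $T_j$. A spherical orthogonal ring pattern on $(S,\Sigma)$ is obtained by gluing all these quadrilaterals isometrically along corresponding sides (around each face the sides of lengths $r_i$ and $R_i$ alternate); conical singularities are allowed at the centers and at the intersection points. With $q$ fixed, the pattern is given by $(r_1,\dots,r_{|F|})$. Curvature. The geodesic segment $O_iO_j$ divides the quadrilateral into two right-angled spherical triangles. Let $\alpha_{i,-}$ and $\alpha_{j,+}$ be the angles of $\triangle O_iv_1O_j$ at $O_i$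 and $O_j$, and let $\alpha_{i,+}$ and $\alpha_{j,-}$ be the angles of $\triangle O_iv_2O_j$ at $O_i$ and $O_j$. Put $$L_{(e,i)}=\alpha_{i,-}\cos r_i+\alpha_{i,+}\cos R_i,\qquad L_{(e,j)}=\alpha_{j,+}\cos R_j+\alpha_{j,-}\cos r_j.$$ The modified combinatorial total geodesic curvature at $O_i$ is $L_i=\sum_{e:\,e<f_i}L_{(e,i)}$. *)

(* Defs.v *)
From HB Require Import structures.
From mathcomp Require Import all_boot all_order all_algebra.
From mathcomp Require Import reals trigo.
From mathcomp Require Import ring lra.

Set Implicit Arguments.
Unset Strict Implicit.
Unset Printing Implicit Defensive.

Import Order.TTheory GRing.Theory Num.Theory.
Local Open Scope ring_scope.

(* A cellular decomposition of a closed (connected, possibly non-orientable)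
   surface, encoded by its flags, i.e. the triangles of the barycentric
   subdivision.  For k = 0, 1, 2 the involution [ak] sends a flag to the flag
   sharing all of its cells except the one of dimension k; these involutions
   have no fixed point because the surface has no boundary.  Cells are the
   orbits of the two involutions that fix them, so a closed cell may be glued
   to itself (loops, multiple edges, edges with the same face on both sides).
   Only the sphere with one vertex and no edge is left out; it has no polygonal
   face. *)
Record cell_decomposition := CellDecomposition {
  flag : finType;
  vertex : finType;
  edge : finType;
  face : finType;
  a0 : flag -> flag;
  a1 : flag -> flag;
  a2 : flag -> flag;
  vertex_of : flag -> vertex;
  edge_of : flag -> edge;
  face_of : flag -> face;
  a0K : involutive a0;
  a1K : involutive a1;
  a2K : involutive a2;
  a0_free : forall x, a0 x != x;
  a1_free : forall x, a1 x != x;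
  a2_free : forall x, a2 x != x;
  a02C : forall x, a0 (a2 x) = a2 (a0 x);
  a02_free : forall x, a0 (a2 x) != x;
  vertex_ofP : forall x y, (vertex_of x == vertex_of y)
    = connect [rel s t | (t == a1 s) || (t == a2 s)] x y;
  edge_ofP : forall x y, (edge_of x == edge_of y)
    = connect [rel s t | (t == a0 s) || (t == a2 s)] x y;
  face_ofP : forall x y, (face_of x == face_of y)
    = connect [rel s t | (t == a0 s) || (t == a1 s)] x y;
  vertex_of_surj : forall v, exists x, vertex_of x = v;
  edge_of_surj : forall e, exists x, edge_of x = e;
  face_of_surj : forall f, exists x, face_of x = f;
  flag_inhabited : exists x : flag, true;
  flag_connected : forall x y,
    connect [rel s t | [|| t == a0 s, t == a1 s | t == a2 s]] x y
}.

(* A side of an edge [e], i.e. an incidence [e < f] counted with multiplicity,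
   is an [a0]-orbit [{x, a0 x}]; [a2] exchanges the two sides of an edge. *)
Definition face_degree (S : cell_decomposition) (f : face S) : nat :=
  fcard (@a0 S) [pred x | face_of x == f].

(* An end of an edge is an [a2]-orbit, so a loop counts twice. *)
Definition vertex_degree (S : cell_decomposition) (v : vertex S) : nat :=
  fcard (@a2 S) [pred x | vertex_of x == v].

Section SphericalGeometry.
Context {R : realType}.
Implicit Types u v w p : 'rV[R]_3.

Definition dot u v : R := (u *m v^T) 0 0.
Definition on_sphere u : Prop := dot u u = 1.
Definition sphere_dist u v : R := acos (dot u v).

(* the initial direction at [p] of the geodesic from [p] to [u] *)
Definition direction p u : 'rV[R]_3 := u - dot p u *: p.

(* the angle at [p] between the geodesics [p u] and [p v] *)
Definition sphere_angle u p v : R :=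
  acos (dot (direction p u) (direction p v) /
        (Num.sqrt (dot (direction p u) (direction p u)) *
         Num.sqrt (dot (direction p v) (direction p v)))).

Definition triple u v w : R := \det (col_mx u (col_mx v w) : 'M[R]_3).

Definition vec3 (x y z : R) : 'rV[R]_3 := \row_(i < 3) [:: x; y; z]`_i.

(* The spherical triangle with a right angle at [(0, 0, 1)] between legs of
   lengths [a] and [b]; this is its angle at the far end of the leg [a]. *)
Definition right_triangle_angle (a b : R) : R :=
  sphere_angle (vec3 0 0 1) (vec3 (sin a) 0 (cos a))
               (vec3 0 (sin b) (cos b)).

End SphericalGeometry.

Section RingPatterns.
Context {R : realType}.

Definition outer_radius (q r : R) : R := acos (q * cos r).

Definition radii (S : cell_decomposition) : {pred {ffun face S -> R}} :=
  [pred r : {ffun face S -> R} | [forall f, 0 < r f < pi / 2]].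

(* A flag [x] is identified with the side from [O_(face_of x)] to the point at
   [vertex_of x] of the quadrilateral of [edge_of x], whose four sides are thus
   [x], [a0 x], [a2 x] and [a0 (a2 x)].  [inner x] says that this side has
   length [r] rather than [R].  Each quadrilateral lies in its own copy of the
   unit sphere: [center] and [corner] are not required to agree on flags of
   different edges.  Quadrilaterals of consecutive edges are glued along the
   sides [x] and [a1 x] ([inner_a1]). *)
Record ring_pattern (S : cell_decomposition) (q : R) := RingPattern {
  radius : {ffun face S -> R};
  inner : flag S -> bool;
  center : flag S -> 'rV[R]_3;
  corner : flag S -> 'rV[R]_3;
  side_length := fun x : flag S =>
    if inner x then radius (face_of x) else outer_radius q (radius (face_of x));
  radius_dom : radius \in @radii S;
  inner_a0 : forall x, inner (a0 x) = ~~ inner x;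
  inner_a1 : forall x, inner (a1 x) = inner x;
  inner_a2 : forall x, inner (a2 x) = ~~ inner x;
  center_sphere : forall x, on_sphere (center x);
  corner_sphere : forall x, on_sphere (corner x);
  center_a0 : forall x, center (a0 x) = center x;
  corner_a2 : forall x, corner (a2 x) = corner x;
  side_lengthP : forall x, sphere_dist (center x) (corner x) = side_length x;
  corner_right : forall x,
    sphere_angle (center x) (corner x) (center (a2 x)) = pi / 2;
  (* the diagonal joining the centers separates the two other corners *)
  diagonal_separates : forall x,
    triple (center x) (center (a2 x)) (corner x) *
    triple (center x) (center (a2 x)) (corner (a0 x)) < 0
}.

Definition center_angle (S : cell_decomposition) (q : R)
    (P : ring_pattern S q) (x : flag S) : R :=
  sphere_angle (corner P x) (center P x) (center P (a2 x)).

(* [L_(e,i)] for the side [{x, a0 x}] of [e] on the face [f_i]; one of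
   [x], [a0 x] is the inner flag of this side and the other the outer one. *)
Definition side_curvature (S : cell_decomposition) (q : R)
    (P : ring_pattern S q) (x : flag S) : R :=
  center_angle P x * cos (side_length P x) +
  center_angle P (a0 x) * cos (side_length P (a0 x)).

(* [froots a0] selects one flag from each [a0]-orbit. *)
Definition total_curvature (S : cell_decomposition) (q : R)
    (P : ring_pattern S q) (f : face S) : R :=
  \sum_(x | (face_of x == f) && froots (@a0 S) x) side_curvature P x.

(* [L_(e,i)] as a function of the inner radii [ri] and [rj] *)
Definition edge_curvature (q ri rj : R) : R :=
  right_triangle_angle ri (outer_radius q rj) * cos ri +
  right_triangle_angle (outer_radius q ri) rj * cos (outer_radius q ri).

Definition curvature_map (S : cell_decomposition) (q : R)
    (r : {ffun face S -> R}) : {ffun face S -> R} :=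
  [ffun f => \sum_(x | (face_of x == f) && froots (@a0 S) x)
     edge_curvature q (r f) (r (face_of (a2 x)))].

End RingPatterns.

Section Agreement.
Context {R : realType}.
Implicit Types u v w p : 'rV[R]_3.

Lemma dotE u v : dot u v = \sum_(i < 3) u 0 i * v 0 i.
Proof. by rewrite /dot mxE; apply: eq_bigr => i _; rewrite mxE. Qed.

Lemma dotC u v : dot u v = dot v u.
Proof. by rewrite !dotE; apply: eq_bigr => i _; rewrite mulrC. Qed.

Lemma dot_direction p u v : on_sphere p ->
  dot (direction p u) (direction p v) = dot u v - dot p u * dot p v.
Proof.
rewrite /on_sphere /direction => pp.
have E a b : dot (u - a *: p) (v - b *: p)
    = dot u v - b * dot p u - a * dot p v + a * b * dot p p.
  by rewrite !dotE !big_ord_recr !big_ord0 /= !mxE; ring.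
by rewrite E pp; ring.
Qed.

Lemma dot_norm_le1 u v : on_sphere u -> on_sphere v -> -1 <= dot u v <= 1.
Proof.
rewrite /on_sphere => uu vv.
have ge0 w : 0 <= dot w w.
  by rewrite dotE; apply: sumr_ge0 => i _; rewrite -expr2 sqr_ge0.
have := ge0 (u - v); have := ge0 (u + v).
have -> : dot (u - v) (u - v) = dot u u + dot v v - 2 * dot u v.
  by rewrite !dotE !big_ord_recr !big_ord0 /= !mxE; ring.
have -> : dot (u + v) (u + v) = dot u u + dot v v + 2 * dot u v.
  by rewrite !dotE !big_ord_recr !big_ord0 /= !mxE; ring.
by rewrite uu vv; lra.
Qed.

Lemma sphere_angleE u p v : on_sphere u -> on_sphere p -> on_sphere v ->
  sphere_angle u p v = acos ((dot u v - dot p u * dot p v) /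
    (Num.sqrt (1 - dot p u ^+ 2) * Num.sqrt (1 - dot p v ^+ 2))).
Proof.
by move=> u1 p1 v1; rewrite /sphere_angle !dot_direction // u1 v1 -!expr2.
Qed.

Lemma dot_vec3 (x y z x' y' z' : R) :
  dot (vec3 x y z) (vec3 x' y' z') = x * x' + y * y' + z * z'.
Proof. by rewrite dotE !big_ord_recr big_ord0 /= !mxE /=; ring. Qed.

Lemma acos_eq_pihalf (t : R) : acos t = pi / 2 -> t = 0.
Proof.
move=> acos_t; have [tB|] := boolP (-1 <= t <= 1).
  by rewrite -[t]acosK ?in_itv // acos_t cos_pihalf.
move: acos_t; rewrite unlock; case: classical_sets.xgetP => [y _ [_ <-] _|_].
  by rewrite cos_geN1 cos_le1.
by move=> /esym/eqP; rewrite gt_eqF // divr_gt0 ?pi_gt0.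
Qed.

Lemma sphere_dist_cos u v (a : R) : on_sphere u -> on_sphere v ->
  sphere_dist u v = a -> dot u v = cos a.
Proof. by move=> u1 v1 <-; rewrite acosK // in_itv /= dot_norm_le1. Qed.

Lemma sphere_angle_right p v w (a b : R) :
  on_sphere p -> on_sphere v -> on_sphere w ->
  0 < a < pi -> 0 < b < pi ->
  sphere_dist p v = a -> sphere_dist w v = b ->
  sphere_angle p v w = pi / 2 ->
  sphere_angle v p w = right_triangle_angle a b.
Proof.
move=> p1 v1 w1 aB bB.
move=> /(sphere_dist_cos p1 v1) pv /(sphere_dist_cos w1 v1) wv.
rewrite (sphere_angleE p1 v1 w1) => /acos_eq_pihalf /eqP.
rewrite (dotC v p) (dotC v w) pv wv -!sin2cos2 !sqrtr_sqr.
rewrite mulf_eq0 invr_eq0 mulf_eq0 !normr_eq0.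
rewrite (gt_eqF (sin_gt0_pi aB)) (gt_eqF (sin_gt0_pi bB)) !orbF subr_eq0 => /eqP pw.
have T1 : on_sphere (vec3 (sin a) 0 (cos a)).
  by rewrite /on_sphere dot_vec3 -(cos2Dsin2 a); ring.
have T2 : on_sphere (vec3 0 (sin b) (cos b)).
  by rewrite /on_sphere dot_vec3 -(cos2Dsin2 b); ring.
have T3 : on_sphere (vec3 0 0 (1 : R)).
  by rewrite /on_sphere dot_vec3; ring.
rewrite /right_triangle_angle !sphere_angleE // !dot_vec3.
rewrite (dotC v w) pv wv pw !mul0r !mulr0 !mul1r !mulr1 !add0r.
done.
Qed.

Lemma outer_radius_dom (q r : R) : 0 < q <= 1 -> 0 < r < pi / 2 ->
  0 < outer_radius q r < pi / 2.
Proof.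
move=> q01 rB; have := pi_gt0 R => pi0.
have c0 : 0 < cos r by apply: cos_gt0_pihalf; lra.
have c1 : cos r < 1.
  by rewrite -cos0 ltr_cos ?in_itv //=; lra.
have t0 : 0 < q * cos r by nra.
have t1 : q * cos r < 1 by nra.
have tB : -1 <= q * cos r <= 1 by lra.
rewrite acos_gt0 /=; last by lra.
rewrite -ltr_cos ?in_itv /= ?acos_ge0 ?acos_lepi //; try lra.
by rewrite cos_pihalf acosK ?in_itv.
Qed.

Lemma total_curvatureE (S : cell_decomposition) (q : R)
    (P : ring_pattern S q) (f : face S) : 0 < q <= 1 ->
  total_curvature P f = curvature_map q (radius P) f.
Proof.
move=> q01; have lenB x : 0 < side_length P x < pi.
  have /forallP/(_ (face_of x)) rB := radius_dom P.
  have : 0 < side_length P x < pi / 2.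
    by rewrite /side_length; case: ifP => _ //; apply: outer_radius_dom.
  by have := pi_gt0 R; lra.
have angE x : center_angle P x
    = right_triangle_angle (side_length P x) (side_length P (a2 x)).
  apply: sphere_angle_right; rewrite ?side_lengthP ?corner_right //.
  all: try exact: center_sphere.
  all: try exact: corner_sphere.
  by rewrite -(corner_a2 P x) side_lengthP.
have faceA0 x : face_of (@a0 S x) = face_of x.
  by apply/esym/eqP; rewrite face_ofP connect1 //= eqxx.
rewrite ffunE; apply: eq_bigr => x /andP[/eqP <- _].
rewrite /side_curvature !angE /edge_curvature /side_length.
rewrite -a02C !inner_a0 !inner_a2 !faceA0.
by case: (inner P x) => //=; rewrite addrC.
Qed.

End Agreement.

(* Main.v *)
(* The proof is a maximum-principle argument.  On an edge between faces of radii
   [ri] and [rj], the curvature [L_(e,i)] increases with [rj], while the sum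
   [L_(e,i) + L_(e,j)] strictly decreases in both radii: by Gauss-Bonnet it is
   [pi] minus half the areas of two lenses cut out by orthogonal circles.  Hence
   [L_(e,i)] strictly decreases with [ri].  If [A] is the set of faces where
   [r < r'], summing [L_i] over [A] and grouping the terms by edges gives
   edges with both sides in [A], contributing [L_(e,i) + L_(e,j)], and edges
   with one side in [A], contributing [L_(e,i)] with [ri] smaller and [rj] not
   smaller for [r] than for [r'].  Each contribution is strictly larger for [r]
   than for [r'], so equal curvatures force [A] to be empty. *)
(* [Defs] comes after [normedtype], which also exports a [radius]. *)
From mathcomp Require Import boolp classical_sets functions topology normedtype.
From mathcomp Require Import derive realfun ring lra.
Require Import Defs.
From mathcomp Require Import all_boot all_order all_algebra.
From mathcomp Require Import reals trigo.

Set Implicit Arguments.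
Unset Strict Implicit.
Unset Printing Implicit Defensive.

Import Order.TTheory GRing.Theory Num.Theory.
Import numFieldNormedType.Exports.
Local Open Scope ring_scope.

(** * Right-angled spherical triangles and monotonicity of the edge curvature *)

Section AcuteAngles.
Context {R : realType}.
Implicit Types a b q r s t : R.

Lemma cos_acute_gt0 a : 0 < a < pi / 2 -> 0 < cos a.
Proof. by move=> aB; apply: cos_gt0_pihalf; have := pi_gt0 R; lra. Qed.

Lemma tan_acute_gt0 a : 0 < a < pi / 2 -> 0 < tan a.
Proof. by move=> aB; rewrite divr_gt0 ?sin_gt0_pihalf ?cos_acute_gt0. Qed.

Lemma ltr_tan_acute a b : 0 < a < pi / 2 -> 0 < b < pi / 2 ->
  (tan a < tan b) = (a < b).
Proof.
by have := pi_gt0 R => pi0 aB bB; rewrite ltr_tan // in_itv /=; lra.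
Qed.

(** By the mean value theorem [atan t] is [t / (1 + c ^+ 2)] for some [c] between [0] and [t]. This
    fixes the sign of the derivative of [lens_curvature]. *)
Lemma ltr_atan_div t : 0 < t -> t / (1 + t ^+ 2) < atan t.
Proof.
move=> t0; have datan z : z \in `]0, t[ -> is_derive z 1 atan (1 + z ^+ 2)^-1.
  by move=> _; exact: is_derive1_atan.
have catan : {within `[0, t], continuous (@atan R)}%classic.
  by apply: derivable_within_continuous => z _; exact: ex_derive.
have [c] := MVT t0 datan catan.
rewrite in_itv /= atan0 !subr0 => /andP[c0 ct] ->.
rewrite mulrC ltr_pM2r // ltf_pV2 ?posrE; nra.
Qed.

(** Napier's rule: the tangent of the angle opposite the leg [b] is [tan b / sin a]. *)
Lemma right_triangle_angleE a b : 0 < a < pi / 2 -> 0 < b < pi / 2 ->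
  right_triangle_angle a b = atan (tan b / sin a).
Proof.
move=> aB bB; have sa := sin_gt0_pihalf aB; have cb := cos_acute_gt0 bB.
have sb := sin_gt0_pihalf bB.
set t := tan b / sin a.
have t0 : 0 < t by rewrite divr_gt0 ?tan_acute_gt0.
have tE : t * sin a * cos b = sin b by rewrite /t /tan; field; lra.
have a0 : 0 < atan t by rewrite -(@atan0 R) lt_atan.
rewrite -[RHS]cosK; last first.
  by rewrite in_itv /= ltW //=; have := atan_ltpi2 t; have := pi_gt0 R; lra.
have T1 : on_sphere (vec3 (sin a) 0 (cos a)).
  by rewrite /on_sphere dot_vec3 -(cos2Dsin2 a); ring.
have T2 : on_sphere (vec3 0 (sin b) (cos b)).
  by rewrite /on_sphere dot_vec3 -(cos2Dsin2 b); ring.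
have T3 : on_sphere (vec3 0 0 (1 : R)).
  by rewrite /on_sphere dot_vec3; ring.
rewrite /right_triangle_angle sphere_angleE // !dot_vec3; congr acos.
rewrite cos_atan !mul0r !mulr0 !mul1r !mulr1 !add0r.
(* The hypotenuse has cosine [cos a * cos b], so the left side is its squared sine. *)
have -> : 1 - (cos a * cos b) ^+ 2 = (sin a * cos b) ^+ 2 * (1 + t ^+ 2).
  have -> : (sin a * cos b) ^+ 2 * (1 + t ^+ 2)
    = sin a ^+ 2 * cos b ^+ 2 + (t * sin a * cos b) ^+ 2 by ring.
  by rewrite tE !sin2cos2; ring.
rewrite sqrtrM ?sqr_ge0 // -sin2cos2 !sqrtr_sqr !gtr0_norm ?mulr_gt0 //.
have -> : cos b - cos a * (cos a * cos b) = sin a ^+ 2 * cos b.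
  by rewrite sin2cos2; ring.
have S0 : Num.sqrt (1 + t ^+ 2) != 0 by rewrite gt_eqF // sqrtr_gt0; nra.
by field; rewrite S0 !gt_eqF.
Qed.

(* [pi / 2] minus half the area of the lens cut out by two orthogonal circles of
   radii [a] and [b]. *)
Definition lens_curvature a b :=
  right_triangle_angle a b * cos a + right_triangle_angle b a * cos b.

(** The rational parts coming from the two angles merge over a common denominator; the [atan] term
    comes from differentiating [cos x]. *)
Lemma is_derive_lens_curvature a b : 0 < a < pi / 2 -> 0 < b < pi / 2 ->
  let t := tan b / sin a in
  is_derive a 1 (fun x => atan (tan b / sin x) * cos x +
                          atan (tan x / sin b) * cos b)
    (sin a * (t / (1 + t ^+ 2) - atan t)).
Proof.
move=> aB bB t; have sa := sin_gt0_pihalf aB; have sb := sin_gt0_pihalf bB.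
have ca := cos_acute_gt0 aB; have cb := cos_acute_gt0 bB.
have sa0 : sin a != 0 by rewrite gt_eqF.
have ca0 : cos a != 0 by rewrite gt_eqF.
have dtan := is_derive_tan ca0.
have dsinV := is_deriveV sa0 (is_derive_sin a).
have d1 : is_derive a 1 (fun x => tan b / sin x) (tan b * (- (sin a) ^- 2 * cos a)).
  exact: is_deriveZ.
have d2 : is_derive a 1 (fun x => tan x / sin b) ((sin b)^-1 * (cos a) ^- 2).
  rewrite (_ : (fun x => _) = (sin b)^-1 \*: tan); first exact: is_deriveZ.
  by apply/funext => x /=; rewrite mulrC.
have d3 := @is_derive1_comp _ atan _ a _ _ (is_derive1_atan _) d1.
have d4 := @is_derive1_comp _ atan _ a _ _ (is_derive1_atan _) d2.
have d5 := is_deriveM d3 (is_derive_cos a).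
have d6 := @is_deriveZ _ _ _ _ (cos b) _ _ _ d4.
have := is_deriveD d5 d6.
rewrite (_ : (_ + _)%R = fun x => atan (tan b / sin x) * cos x +
                          atan (tan x / sin b) * cos b); last first.
  by apply/funext => x /=; rewrite /GRing.add /= /GRing.mul /= [X in _ + X]mulrC.
move=> d; apply: (is_derive_eq d).
(* [D] is the squared sine of the hypotenuse, hence symmetric in [a] and [b]; this makes it the
   denominator for both angles. *)
set D := sin b ^+ 2 + sin a ^+ 2 * cos b ^+ 2.
have DE : D = sin a ^+ 2 + sin b ^+ 2 * cos a ^+ 2.
  by rewrite /D !sin2cos2; ring.
have D0 : D != 0 by rewrite gt_eqF // /D; nra.
have E1 : (1 + (tan b / sin a) ^+ 2)^-1 = sin a ^+ 2 * cos b ^+ 2 / D.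
  by rewrite /D /tan; field; rewrite exprMn -/D D0 !gt_eqF.
have E2 : (1 + (tan a / sin b) ^+ 2)^-1 = sin b ^+ 2 * cos a ^+ 2 / D.
  by rewrite DE /tan; field; rewrite exprMn -DE D0 !gt_eqF.
rewrite /t /GRing.scale /= E1 E2 /tan.
transitivity (sin b * cos b * (1 - cos a ^+ 2) / D
              - sin a * atan (sin b / cos b / sin a)).
  by field; rewrite D0 !gt_eqF.
by rewrite -sin2cos2; field; rewrite D0 !gt_eqF.
Qed.

Lemma lens_curvature_decr a a' b : 0 < b < pi / 2 ->
  0 < a -> a < a' -> a' < pi / 2 -> lens_curvature a' b < lens_curvature a b.
Proof.
move=> bB a0 aa' a'B.
rewrite /lens_curvature !right_triangle_angleE //; try lra.
pose f x := atan (tan b / sin x) * cos x + atan (tan x / sin b) * cos b.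
have df x : x \in `[a, a'] -> is_derive x 1 f
    (sin x * (tan b / sin x / (1 + (tan b / sin x) ^+ 2) - atan (tan b / sin x))).
  rewrite in_itv /= => /andP[ax xa']; apply: is_derive_lens_curvature => //; lra.
apply: (@ltr0_derive1_decr R f a a' _ _ _ a a') => // [x xI|x xI|].
- by have [] := df x (subset_itv_oo_cc xI).
- rewrite derive1E; have dx := df x (subset_itv_oo_cc xI).
  rewrite derive_val; move: xI; rewrite in_itv /= => /andP[ax xa'].
  have sx : 0 < sin x by apply: sin_gt0_pihalf; lra.
  rewrite pmulr_rlt0 // subr_lt0; apply: ltr_atan_div.
  by rewrite divr_gt0 ?tan_acute_gt0.
- by apply: derivable_within_continuous => x /df [].
Qed.

Lemma ltr_outer_radius q r r' : 0 < q <= 1 ->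
  0 < r < pi / 2 -> 0 < r' < pi / 2 -> r < r' ->
  outer_radius q r < outer_radius q r'.
Proof.
move=> q01 rB r'B rr'; have := pi_gt0 R => pi0.
have RB := outer_radius_dom q01 rB; have R'B := outer_radius_dom q01 r'B.
rewrite -ltr_cos ?in_itv /=; try lra.
have cE s : 0 < s < pi / 2 -> cos (outer_radius q s) = q * cos s.
  move=> sB; rewrite acosK // in_itv /=.
  by have := cos_acute_gt0 sB; have := cos_le1 s; nra.
rewrite !cE // ltr_pM2l ?ltr_cos ?in_itv /=; lra.
Qed.

(** Both angles at the center of face [i] face a leg, [outer_radius q rj] or [rj], that grows with
    [rj], while the other legs and the cosine weights stay fixed. *)
Lemma edge_curvature_incr q ri rj rj' : 0 < q <= 1 ->
  0 < ri < pi / 2 -> 0 < rj < pi / 2 -> 0 < rj' < pi / 2 -> rj < rj' ->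
  edge_curvature q ri rj < edge_curvature q ri rj'.
Proof.
move=> q01 riB rjB rj'B lt_rj; rewrite /edge_curvature.
have RiB := outer_radius_dom q01 riB.
have RjB := outer_radius_dom q01 rjB; have Rj'B := outer_radius_dom q01 rj'B.
rewrite !right_triangle_angleE //.
apply: ltrD; rewrite ltr_pM2r ?cos_acute_gt0 //; apply: lt_atan.
- rewrite ltr_pM2r ?invr_gt0 ?sin_gt0_pihalf // ltr_tan_acute //.
  exact: ltr_outer_radius.
- by rewrite ltr_pM2r ?invr_gt0 ?sin_gt0_pihalf // ltr_tan_acute.
Qed.

Lemma edge_curvature_sum_decr q ri ri' rj : 0 < q <= 1 ->
  0 < ri < pi / 2 -> 0 < ri' < pi / 2 -> 0 < rj < pi / 2 -> ri < ri' ->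
  edge_curvature q ri' rj + edge_curvature q rj ri' <
  edge_curvature q ri rj + edge_curvature q rj ri.
Proof.
move=> q01 riB ri'B rjB lt_ri.
(* Regroup the four angles by triangle instead of by center: each of the two right triangles gives
   one lens. *)
have E x y : edge_curvature q x y + edge_curvature q y x =
    lens_curvature x (outer_radius q y) + lens_curvature (outer_radius q x) y.
  by rewrite /edge_curvature /lens_curvature; ring.
have RiB := outer_radius_dom q01 riB; have Ri'B := outer_radius_dom q01 ri'B.
have RjB := outer_radius_dom q01 rjB.
have := ltr_outer_radius q01 riB ri'B lt_ri.
by rewrite !E => lt_Ri; apply: ltrD; apply: lens_curvature_decr => //; lra.
Qed.

(** The sum over both sides decreases in [ri], yet the share of the other side increases. *)
Lemma edge_curvature_decr q ri ri' rj : 0 < q <= 1 ->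
  0 < ri < pi / 2 -> 0 < ri' < pi / 2 -> 0 < rj < pi / 2 -> ri < ri' ->
  edge_curvature q ri' rj < edge_curvature q ri rj.
Proof.
move=> q01 riB ri'B rjB lt_ri.
have := edge_curvature_sum_decr q01 riB ri'B rjB lt_ri.
by have := edge_curvature_incr q01 rjB riB ri'B lt_ri; lra.
Qed.

End AcuteAngles.

(** * Summation over sides and injectivity *)

Section Sides.
Context {R : realType} (S : cell_decomposition).
Implicit Types x y : flag S.

Lemma face_of_a0 x : face_of (a0 x) = face_of x.
Proof. by apply/esym/eqP; rewrite face_ofP connect1 //= eqxx. Qed.

Lemma fconnect_a0 x y : fconnect (@a0 S) x y -> y = x \/ y = a0 x.
Proof.
move=> /iter_findex <-; elim: (findex _ _ _) => [|n [] IH] /=; first by left.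
  by right; rewrite IH.
by left; rewrite IH a0K.
Qed.

Lemma froots_a0 x : froots (@a0 S) (a0 x) = ~~ froots (@a0 S) x.
Proof.
have sym : connect_sym (frel (@a0 S)) by apply: fconnect_sym; exact: (can_inj (@a0K S)).
rewrite /roots.
have -> : froot (@a0 S) (a0 x) = froot (@a0 S) x.
  by apply/esym/fingraph.rootP => //; apply: fconnect1.
have [->|->] := fconnect_a0 (connect_root (frel (@a0 S)) x).
  by rewrite eqxx eq_sym (negPf (a0_free x)).
by rewrite eqxx a0_free.
Qed.

(* Every [a0]-orbit has two flags, one of them its root. *)
Lemma sum_froots (A : pred (face S)) (G : flag S -> R) :
  (forall x, G (a0 x) = G x) ->
  \sum_(x | A (face_of x)) G x =
  2 * \sum_(x | A (face_of x) && froots (@a0 S) x) G x.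
Proof.
move=> G0; rewrite (bigID (froots (@a0 S))) /= [in RHS]mulr_natl mulr2n.
congr (_ + _); rewrite (reindex_inj (can_inj (@a0K S))) /=.
by apply: eq_big => x; rewrite ?face_of_a0 ?froots_a0 ?negbK.
Qed.

(** One factor 2 passes from [a0]-roots to all flags; the other adds the same sum reindexed by [a2],
    so that each summand sees both sides of its edge. *)
Lemma sum_curvature_map (A : pred (face S)) (q : R) (r : {ffun face S -> R}) :
  2 * (2 * \sum_(f | A f) curvature_map q r f) =
  \sum_x ((if A (face_of x) then
             edge_curvature q (r (face_of x)) (r (face_of (a2 x))) else 0) +
          (if A (face_of (a2 x)) then
             edge_curvature q (r (face_of (a2 x))) (r (face_of x)) else 0)).
Proof.
set G := fun x => edge_curvature q (r (face_of x)) (r (face_of (a2 x))).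
have -> : \sum_(f | A f) curvature_map q r f =
    \sum_(x | A (face_of x) && froots (@a0 S) x) G x.
  rewrite (partition_big (@face_of S) A) => [|x /andP[] //].
  apply: eq_bigr => f Af; rewrite ffunE; apply: eq_big => [x|x /andP[/eqP <-] //].
  by have [->|] := eqVneq (face_of x) f; rewrite ?Af ?andbT ?andbF.
rewrite -sum_froots => [|x]; last by rewrite /G -a02C !face_of_a0.
rewrite mulr_natl mulr2n [RHS]big_split /=; congr (_ + _); rewrite big_mkcond //.
rewrite (reindex_inj (can_inj (@a2K S))) /=.
by apply: eq_bigr => x _; rewrite /G a2K.
Qed.

Lemma curvature_map_le (q : R) (r r' : {ffun face S -> R}) : 0 < q <= 1 ->
  r \in @radii R S -> r' \in @radii R S ->
  curvature_map q r = curvature_map q r' -> forall f, r' f <= r f.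
Proof.
move=> q01 /forallP rB /forallP r'B eq_rr' f; rewrite leNgt; apply/negP => lt_f.
pose A g := r g < r' g.
have /eqP := congr1 (fun h : {ffun face S -> R} =>
  2 * (2 * \sum_(g | A g) h g)) eq_rr'.
rewrite /= !sum_curvature_map -subr_eq0 -sumrB.
have [x0 x0f] := face_of_surj f.
set D := BIG_F.
(* [D x] is the contribution at [x] for [r] minus that for [r']. *)
have D_gt0 x : A (face_of x) || A (face_of (a2 x)) -> 0 < D x.
  rewrite /D subr_gt0; set i := face_of x; set j := face_of (a2 x).
  have ri := rB i; have ri' := r'B i; have rj := rB j; have rj' := r'B j.
  case: ifP => Ai; case: ifP => Aj //= _; rewrite ?addr0 ?add0r.
  (* Both faces lie in [A]: change one radius at a time, using the symmetry of the sum. *)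
  - apply: lt_trans (edge_curvature_sum_decr q01 ri ri' rj Ai).
    by rewrite addrC [ltRHS]addrC; exact: edge_curvature_sum_decr.
  - apply: lt_le_trans (edge_curvature_decr q01 ri ri' rj' Ai) _.
    move: Aj => /negbT; rewrite -leNgt le_eqVlt.
    by case/predU1P => [->//|lt_j]; apply/ltW/edge_curvature_incr.
  - apply: lt_le_trans (edge_curvature_decr q01 rj rj' ri' Aj) _.
    move: Ai => /negbT; rewrite -leNgt le_eqVlt.
    by case/predU1P => [->//|lt_i]; apply/ltW/edge_curvature_incr.
(* The flag [x0] of [f] gives a positive term, and flags whose edge misses [A] give zero, so the
   difference cannot vanish. *)
rewrite (bigD1 x0) //= gt_eqF // ltr_pwDl ?D_gt0 ?x0f ?/A ?lt_f //.
apply: sumr_ge0 => x _.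
have [/D_gt0/ltW //|] := boolP (A (face_of x) || A (face_of (a2 x))).
by rewrite /D negb_or => /andP[/negPf -> /negPf ->]; rewrite subrr.
Qed.

Lemma curvature_map_inj (q : R) : 0 < q <= 1 ->
  {in @radii R S &, injective (curvature_map (S := S) q)}.
Proof.
move=> q01 r r' rB r'B eq_rr'; apply/ffunP => f; apply/eqP.
by rewrite eq_le (curvature_map_le q01 _ _ eq_rr') //
  (curvature_map_le q01 _ _ (esym eq_rr')).
Qed.

End Sides.

Theorem theorem1p5 (R : realType) (S : cell_decomposition) (q : R)
    (face_even : forall f : face S, ~~ odd (face_degree f))
    (vertex_even : forall v : vertex S, ~~ odd (vertex_degree v))
    (q_dom : 0 < q <= 1) :
  (forall P P' : ring_pattern S q,
     (forall f, total_curvature P f = total_curvature P' f) ->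
     forall f, radius P f = radius P' f)
  /\ {in @radii R S &, injective (curvature_map q)}.
Proof.
split; last exact: curvature_map_inj.
move=> P P' eqL f; congr (fun_of_fin _ f).
apply: (curvature_map_inj q_dom); rewrite ?radius_dom //.
by apply/ffunP => g; rewrite -!total_curvatureE.
Qed.
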